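(* Let $K$ be a field with $\mathrm{char}(K)=0$ or $\mathrm{char}(K)>n$, with algebraic closure $\overline{K}$, and let $n,\alpha$ be integers with $2\le\alpha\le n-1$. Then the dimension of the algebraic variety $$S_{n,\alpha}=\{(A,B)\in M_n(\overline{K})^2 \;|\; B\text{ is nilpotent and } AB-BA=A^{\alpha}\}$$ is $n^2-1$.
   Context: $S_{n,\alpha}$ is regarded as a (possibly reducible) closed affine algebraic set in $M_n(\overline{K})^2\cong\overline{K}^{2n^2}$; its dimension is the maximum of the dimensions of its irreducible components. *)

(* Defs.v *)
From HB Require Import structures.
From mathcomp Require Import all_boot all_algebra.
From mathcomp Require Import classical_sets.
From mathcomp Require Import mpoly.
Set Implicit Arguments.
Unset Strict Implicit.
Unset Printing Implicit Defensive.
Import GRing.Theory.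
Local Open Scope ring_scope.
Local Open Scope classical_set_scope.

Definition zero_locus (L : fieldType) (N : nat) (I : set {mpoly L[N]}) :
  set 'rV[L]_N := [set x | forall p, I p -> p.@[x ord0] = 0].

Definition zariski_closed (L : fieldType) (N : nat) (X : set 'rV[L]_N) : Prop :=
  exists I : set {mpoly L[N]}, X = zero_locus I.

Definition irreducible_closed (L : fieldType) (N : nat) (X : set 'rV[L]_N) :
  Prop :=
  [/\ zariski_closed X, X !=set0
    & forall Y Z : set 'rV[L]_N, zariski_closed Y -> zariski_closed Z ->
        X = Y `|` Z -> X = Y \/ X = Z].

Definition irreducible_component (L : fieldType) (N : nat)
  (V X : set 'rV[L]_N) : Prop :=
  [/\ irreducible_closed X, X `<=` V
    & forall Y : set 'rV[L]_N, irreducible_closed Y -> Y `<=` V ->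
        X `<=` Y -> Y = X].

(* A chain Z 0 < Z 1 < ... < Z d of irreducible closed subsets of X has
   length d; the values Z i for d < i are irrelevant. *)
Definition irreducible_chain (L : fieldType) (N : nat) (X : set 'rV[L]_N)
  (d : nat) (Z : nat -> set 'rV[L]_N) : Prop :=
  (forall i, (i <= d)%N -> irreducible_closed (Z i) /\ Z i `<=` X) /\
  (forall i, (i < d)%N -> Z i `<` Z i.+1).

(* Krull dimension of the Zariski topology. *)
Definition irreducible_dim (L : fieldType) (N : nat) (X : set 'rV[L]_N)
  (d : nat) : Prop :=
  (exists Z, irreducible_chain X d Z) /\
  (forall e Z, irreducible_chain X e Z -> (e <= d)%N).

(* Meant for closed V: the maximum of the dimensions of its components. *)
Definition algebraic_set_dim (L : fieldType) (N : nat) (V : set 'rV[L]_N)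
  (d : nat) : Prop :=
  (exists X, irreducible_component V X /\ irreducible_dim X d) /\
  (forall X, irreducible_component V X ->
     exists2 e, irreducible_dim X e & (e <= d)%N).

Definition nilpotent_mx (L : fieldType) (n : nat) (B : 'M[L]_n) : Prop :=
  exists k : nat, B ^+ k = 0.

Definition Sset (L : fieldType) (n alpha : nat) : set ('M[L]_n * 'M[L]_n) :=
  [set AB | nilpotent_mx AB.2 /\
            AB.1 *m AB.2 - AB.2 *m AB.1 = AB.1 ^+ alpha].

(* The entries of A, then those of B, both in row-major order. *)
Definition pair_coords (L : fieldType) (n : nat) (AB : 'M[L]_n * 'M[L]_n) :
  'rV[L]_(n * n + n * n) := row_mx (mxvec AB.1) (mxvec AB.2).

(* Main.v *)
Require Import Defs.
From HB Require Import structures.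
From mathcomp Require Import all_boot all_algebra.
From mathcomp Require Import boolp classical_sets.
From mathcomp Require Import mpoly.
From mathcomp Require Import zify.
Set Implicit Arguments.
Unset Strict Implicit.
Unset Printing Implicit Defensive.
Import GRing.Theory.
Local Open Scope ring_scope.
Local Open Scope classical_set_scope.

(** A point (A, B) of the locus satisfies A B - B A = A^alpha. Dimensions are
    lengths of chains of irreducible closed sets, so two things are needed: no
    chain in the locus is longer than n^2 - 1, and some chain has this length
    (algebraic_set_dim_chain).

    Upper bound. A chain of length d yields d algebraically independent
    polynomial functions on its largest member (chain_alg_indep). Drop the
    nilpotency of B and let T be the set of all solutions of the equation. If
    (A, B) is in the locus, then (A, B + c) is in T for every scalar c, and c is
    recovered as tr B / n since n is invertible; hence T carries one more
    independent function than the locus (alg_indep_line), and it suffices to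
    show that n^2 + 1 functions on T are dependent. For this T is covered by
    finitely many images of affine n^2-space under rational maps
    (commutator_set_covered), and D + 1 rational functions of D parameters are
    dependent by counting monomials (regular_dependent). The covering is built
    by induction on n. A trace argument shows that A is singular
    (commutator_set_singular, where the hypothesis on the characteristic is
    used). The equation makes the left kernel of A stable under B, so that (A, B)
    is block triangular: one block is a smaller solution of the same equation,
    and the rest is a linear system of full rank. The parameters always add up to
    n^2, whatever the rank of A (chart, chart_surj).

    Lower bound. The regular nilpotent matrices A, with the nilpotent solutions B
    of the equation, give a family with n^2 - n + n - 1 parameters, from which
    the parameters can be recovered rationally (param_point, separatorE). The
    closures of the images of an increasing sequence of coordinate subspaces of
    the parameter space form a strictly increasing chain of irreducible closed
    sets (param_chain, Sset_chain). *)

(** * Algebraic independence of functions *)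

Section AlgebraicIndependence.
Variable L : closedFieldType.

Lemma muni_eq0 n (p : {mpoly L[n.+1]}) : muni p = 0 -> p = 0.
Proof.
move=> p0; apply/mpolyP => m; rewrite mcoeff0.
pose r (m : 'X_{1..n.+1}) := [multinom m (widen_ord (leqnSn n) i) | i < n].
have r_inj m1 m2 : r m1 = r m2 -> m1 ord_max = m2 ord_max -> m1 = m2.
  move=> e1 e2; apply/mnmP => i.
  case: (unliftP ord_max i) => [j ->|-> //].
  have -> : lift ord_max j = widen_ord (leqnSn n) j.
    by apply/val_inj => /=; rewrite /bump leqNgt ltn_ord.
  by have /mnmP/(_ j) := e1; rewrite !mnmE.
have := congr1 (fun q : {poly {mpoly L[n]}} => (q`_(m ord_max))@_(r m)) p0.
rewrite coef0 mcoeff0 muniE coef_sum raddf_sum /= => <-.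
have E (k : 'X_{1..n.+1}) : (p@_k *: 'X_[r k] *: 'X^(k ord_max))`_(m ord_max)@_(r m)
   = p@_k * (k == m)%:R.
  rewrite coefZ coefXn mulr_natr mcoeffMn mcoeffZ mcoeffX -mulrnAr -mulrnA mulnb.
  congr (_ * (nat_of_bool _)%:R); apply/andP/eqP => [[/eqP e1 /eqP e2]|-> //].
  exact: r_inj.
rewrite (eq_bigr _ (fun k _ => E k)).
have [mp|mNp] := boolP (m \in msupp p); last first.
  rewrite (memN_msupp_eq0 mNp) big1_seq // => k /andP[_ kp].
  by case: eqP => [e|_]; [rewrite -e kp in mNp | rewrite mulr0].
rewrite (bigD1_seq m) ?msupp_uniq //= eqxx mulr1 big1 ?addr0 // => k /negPf ->.
by rewrite mulr0.
Qed.

Lemma muni_eval n (p : {mpoly L[n.+1]}) (v : nat -> L) :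
  p.@[fun i : 'I_n.+1 => v i] =
  (map_poly (meval (fun i : 'I_n => v i)) (muni p)).[v n].
Proof.
rewrite muniE mevalE rmorph_sum /= horner_sum; apply: eq_bigr => m _.
rewrite -mul_polyC rmorphM /= map_polyC map_polyXn hornerCM hornerXn /=.
rewrite mevalZ mevalX big_ord_recr /= mulrA.
by congr (_ * _ * _); apply: eq_bigr => i _; rewrite mnmE.
Qed.

(** The family is indexed by nat, and only its first d members count, so that
    it can be lengthened by one function without reindexing. *)
Definition alg_indep (X : Type) (W : set X) d (f : nat -> X -> L) :=
  forall P : {mpoly L[d]},
    (forall w, W w -> P.@[fun i : 'I_d => f i w] = 0) -> P = 0.

(** A polynomial in d+1 variables seen as a polynomial in the last one: this
    is the form in which the last variable can be divided out. *)
Definition eval_last (X : Type) d (f : nat -> X -> L) (q : {poly {mpoly L[d]}}) w :=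
  (map_poly (meval (fun i : 'I_d => f i w)) q).[f d w].

(** If P is a relation between the f i, its part free of the last variable
    is a relation on W', where f d vanishes, hence is zero; then P is divisible
    by the last variable, and f d cancels on W. Induction on the degree of P
    in the last variable concludes. *)
Lemma alg_indep_vanishing (X : Type) (W W' : set X) d (f : nat -> X -> L) :
  W' `<=` W -> (forall w, W' w -> f d w = 0) ->
  (forall q : {poly {mpoly L[d]}},
     (forall w, W w -> f d w * eval_last f q w = 0) ->
     forall w, W w -> eval_last f q w = 0) ->
  alg_indep W' d f -> alg_indep W d.+1 f.
Proof.
move=> sW f0 nzd ind P Pf; apply: muni_eq0.
have {Pf} : forall w, W w -> eval_last f (muni P) w = 0.
  by move=> w Ww; rewrite /eval_last -(muni_eval P (f^~ w)) Pf.
elim/poly_ind: (muni P) => // q c IH qc0.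
have E w : eval_last f (q * 'X + c%:P) w =
    f d w * eval_last f q w + c.@[fun i : 'I_d => f i w].
  by rewrite /eval_last rmorphD rmorphM /= map_polyX map_polyC !hornerE mulrC.
have c0 : c = 0.
  apply: ind => w Ww; have := qc0 w (sW w Ww).
  by rewrite E f0 // mul0r add0r.
rewrite c0 addr0 IH ?mul0r //; apply: nzd => w Ww.
by have := qc0 w Ww; rewrite E c0 meval0 addr0.
Qed.

Lemma infinite_root (p : {poly L}) : (forall c, p.[c] = 0) -> p = 0.
Proof.
move=> p0; apply/eqP/negPn/negP => pn0.
have [s ps] := closed_field_poly_normal p.
have : exists c, ~~ root (\prod_(z <- s) ('X - z%:P)) c.
  apply/closed_nonrootP; rewrite prodf_seq_neq0; apply/allP => z _.
  by rewrite polyXsubC_eq0.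
case=> c; apply/negP; rewrite negbK /root.
by have := p0 c; rewrite ps hornerZ => /eqP; rewrite mulf_eq0 lead_coef_eq0 (negPf pn0).
Qed.

(** When W' contains a copy of W times the affine line, on which g d is the
    coordinate of the line, every coefficient of a relation with respect to
    its last variable is a relation on W, because a polynomial vanishing on
    the whole of the infinite field L is zero. *)
Lemma alg_indep_line (X Y : Type) (W : set X) (W' : set Y) d (f : nat -> X -> L)
  (g : nat -> Y -> L) :
  (forall w c, W w -> exists y, [/\ W' y, g d y = c &
     forall i, (i < d)%N -> g i y = f i w]) ->
  alg_indep W d f -> alg_indep W' d.+1 g.
Proof.
move=> line ind P Pg; apply: muni_eq0; apply/polyP => k; rewrite coef0.
apply: ind => w Ww.
suff /(congr1 (fun q : {poly L} => q`_k)) :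
    map_poly (meval (fun i : 'I_d => f i w)) (muni P) = 0.
  by rewrite coef0 coef_map.
apply: infinite_root => c; have [y [Wy gdy giy]] := line w c Ww.
rewrite -[RHS](Pg y Wy) (muni_eval P (g^~ y)) gdy; congr (_.[_]).
apply: eq_map_poly => q; apply: meval_eq => i.
by rewrite giy.
Qed.
End AlgebraicIndependence.

(** * Chains of irreducible closed sets *)

Section Chains.
Variable L : closedFieldType.

Lemma alg_indep_eq (X : Type) (W : set X) d (f g : nat -> X -> L) :
  (forall w i, W w -> (i < d)%N -> f i w = g i w) ->
  alg_indep W d f -> alg_indep W d g.
Proof.
move=> fg ind P Pg; apply: ind => w Ww; rewrite -[RHS](Pg w Ww).
by apply: meval_eq => i; apply: fg.
Qed.

Lemma alg_indep0 (X : Type) (W : set X) (f : nat -> X -> L) :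
  W !=set0 -> alg_indep W 0 f.
Proof.
move=> [w Ww] P /(_ w Ww); rewrite (nvar0_mpolyC P) mevalC => ->.
by rewrite mpolyC0.
Qed.

Lemma zariski_closed_hypersurface N (X : set 'rV[L]_N) (p : {mpoly L[N]}) :
  zariski_closed X -> zariski_closed [set x | X x /\ p.@[x ord0] = 0].
Proof.
case=> I ->; exists (fun q => I q \/ q = p); apply/seteqP; split=> x /=.
  by move=> [Ix px] q [/Ix|->].
by move=> h; split=> [q Iq|]; apply: h; [left | right].
Qed.

Lemma irreducible_closed_mul N (X : set 'rV[L]_N) (p q : {mpoly L[N]}) :
  irreducible_closed X ->
  (forall x, X x -> p.@[x ord0] * q.@[x ord0] = 0) ->
  (forall x, X x -> p.@[x ord0] = 0) \/ (forall x, X x -> q.@[x ord0] = 0).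
Proof.
case=> cX _ irr pq0.
have := irr _ _ (zariski_closed_hypersurface p cX)
  (zariski_closed_hypersurface q cX).
case.
- apply/seteqP; split=> x /=; last by case=> [[]|[]].
  move=> Xx; have /eqP := pq0 x Xx.
  by rewrite mulf_eq0 => /orP[]/eqP; [left|right].
- by move=> E; left=> x; rewrite {1}E => -[].
- by move=> E; right=> x; rewrite {1}E => -[].
Qed.

(** The i-th polynomial is chosen to vanish on Z i but not on Z i.+1. It is then
    a nonzero element of the domain of functions on Z i.+1, which is exactly
    what lengthening an independent family by one function requires. Thus
    bounding the length of chains is reduced to exhibiting algebraic
    relations. *)
Lemma chain_alg_indep N (X : set 'rV[L]_N) d Z :
  irreducible_chain X d Z ->
  exists p : nat -> {mpoly L[N]},
    alg_indep (Z d) d (fun i x => (p i).@[x ord0]).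
Proof.
elim: d => [|d IH] [irrZ ltZ].
  by exists (fun=> 0); apply: alg_indep0; have [[]] := irrZ 0 (leqnn _).
have [|p ind] := IH.
  by split=> i le_id; [apply: irrZ; apply: leqW | apply: ltZ; apply: leqW].
have [[[I ZI] _ _] _] := irrZ d (leqnSn _).
have [irrZd _] := irrZ d.+1 (leqnn _).
have [sZ [x /= Zx NZx]] : Z d `<` Z d.+1 /\ exists2 x, Z d.+1 x & ~ Z d x.
  have ltZd := ltZ d (leqnn _); split=> //; apply: contrapT => nex.
  case: ltZd => _; apply=> x Zx; apply: contrapT => NZx.
  by apply: nex; exists x.
have [g Ig gx] : exists2 g, I g & g.@[x ord0] <> 0.
  apply: contrapT => nex; apply: NZx; rewrite ZI => g Ig.
  by apply: contrapT => gx; apply: nex; exists g.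
exists (fun i => if (i < d)%N then p i else g).
apply: (@alg_indep_vanishing _ _ _ (Z d)).
- by case: sZ.
- by move=> w; rewrite ltnn ZI => /(_ g Ig).
- move=> q; pose Q : {mpoly L[N]} :=
    (map_poly (comp_mpoly [tuple p i | i < d]) q).[g].
  have QE w : eval_last
      (fun i (x : 'rV[L]_N) => (if (i < d)%N then p i else g).@[x ord0]) q w = Q.@[w ord0].
    rewrite /eval_last ltnn /Q -horner_map -map_poly_comp; congr (_.[_]).
    apply: eq_map_poly => c /=; rewrite comp_mpoly_meval; apply: meval_eq => i.
    by rewrite tnth_mktuple ltn_ord.
  move=> gQ; have [w Zw||] := irreducible_closed_mul (p := g) (q := Q) irrZd.
  + by have := gQ w Zw; rewrite QE ltnn.
  + by move/(_ x Zx).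
  + by move=> Q0 w Zw; rewrite QE Q0.
- by apply: alg_indep_eq ind => w i _ ->.
Qed.
End Chains.

(** * Regular functions of finitely many parameters *)

Section RegularFunctions.
Variable L : closedFieldType.

(** X is a parameter space with coordinates t, and the fraction is only required
    to make sense on U. *)
Definition regular (X : Type) D (t : X -> 'I_D -> L) (U : set X) (h : X -> L) :=
  exists p q : {mpoly L[D]}, forall x, U x ->
    q.@[t x] != 0 /\ h x = p.@[t x] / q.@[t x].

Section Closure.
Variables (X : Type) (D : nat) (t : X -> 'I_D -> L) (U : set X).
Local Notation reg := (regular t U).

Lemma regular_eq h h' : (forall x, U x -> h x = h' x) -> reg h -> reg h'.
Proof.
by move=> e [p [q pq]]; exists p, q => x Ux; rewrite -e //; apply: pq.
Qed.

Lemma regular_cst c : reg (fun=> c).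
Proof. by exists c%:MP, 1 => x _; rewrite meval1 oner_neq0 mevalC divr1. Qed.

Lemma regular_coord i : reg (fun x => t x i).
Proof. by exists 'X_i, 1 => x _; rewrite meval1 oner_neq0 mevalXU divr1. Qed.

Lemma regularD h h' : reg h -> reg h' -> reg (fun x => h x + h' x).
Proof.
move=> [p [q pq]] [p' [q' pq']]; exists (p * q' + p' * q), (q * q') => x Ux.
have [q0 ->] := pq x Ux; have [q0' ->] := pq' x Ux.
by rewrite mevalD !mevalM mulf_neq0 // addf_div.
Qed.

Lemma regularM h h' : reg h -> reg h' -> reg (fun x => h x * h' x).
Proof.
move=> [p [q pq]] [p' [q' pq']]; exists (p * p'), (q * q') => x Ux.
have [q0 ->] := pq x Ux; have [q0' ->] := pq' x Ux.
by rewrite !mevalM mulf_neq0 // mulf_div.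
Qed.

Lemma regularV h : (forall x, U x -> h x != 0) -> reg h -> reg (fun x => (h x)^-1).
Proof.
move=> h0 [p [q pq]]; exists q, p => x Ux; have [q0 hE] := pq x Ux.
have := h0 x Ux; rewrite hE mulf_eq0 invr_eq0 negb_or => /andP[-> _].
by rewrite invf_div.
Qed.

Lemma regular_sum (I : Type) (r : seq I) (P : pred I) (h : I -> X -> L) :
  (forall i, P i -> reg (h i)) -> reg (fun x => \sum_(i <- r | P i) h i x).
Proof.
move=> hr; elim: r => [|i r IH].
  by apply: regular_eq (regular_cst 0) => x _; rewrite big_nil.
have [Pi|Pi] := boolP (P i).
  by apply: regular_eq (regularD (hr i Pi) IH) => x _; rewrite big_cons Pi.
by apply: regular_eq IH => x _; rewrite big_cons (negPf Pi).
Qed.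

Lemma regular_prod (I : Type) (r : seq I) (P : pred I) (h : I -> X -> L) :
  (forall i, P i -> reg (h i)) -> reg (fun x => \prod_(i <- r | P i) h i x).
Proof.
move=> hr; elim: r => [|i r IH].
  by apply: regular_eq (regular_cst 1) => x _; rewrite big_nil.
have [Pi|Pi] := boolP (P i).
  by apply: regular_eq (regularM (hr i Pi) IH) => x _; rewrite big_cons Pi.
by apply: regular_eq IH => x _; rewrite big_cons (negPf Pi).
Qed.

Lemma regularXn h k : reg h -> reg (fun x => h x ^+ k).
Proof.
move=> hr; apply: regular_eq (regular_prod (index_enum 'I_k) (P := xpredT) (fun=> fun=> hr)).
by move=> x _ /=; rewrite prodr_const card_ord.
Qed.

Lemma regular_meval M (p : {mpoly L[M]}) (y : X -> 'I_M -> L) :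
  (forall i, reg (fun x => y x i)) -> reg (fun x => p.@[y x]).
Proof.
move=> yr; apply: (@regular_eq (fun x => \sum_(m <- msupp p) p@_m * \prod_i y x i ^+ m i)).
  by move=> x _; rewrite mevalE.
apply: regular_sum => m _; apply: regularM; first exact: regular_cst.
by apply: regular_prod => i _; apply: regularXn.
Qed.

(** Matrices with regular entries: the matrix operations, including inversion
    where it is defined, preserve regularity. *)
Definition mxregular m n (M : X -> 'M[L]_(m, n)) :=
  forall i j, reg (fun x => M x i j).

Lemma mxregular_eq m n (M M' : X -> 'M[L]_(m, n)) :
  (forall x, U x -> M x = M' x) -> mxregular M -> mxregular M'.
Proof. by move=> e rM i j; apply: regular_eq (rM i j) => x Ux; rewrite e. Qed.

Lemma mxregular_cst m n (M : 'M[L]_(m, n)) : mxregular (fun=> M).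
Proof. by move=> i j; apply: regular_cst. Qed.

Lemma mxregularD m n (M N : X -> 'M[L]_(m, n)) :
  mxregular M -> mxregular N -> mxregular (fun x => M x + N x).
Proof.
move=> rM rN i j; apply: regular_eq (regularD (rM i j) (rN i j)) => x _.
by rewrite mxE.
Qed.

Lemma mxregularM m n p (M : X -> 'M[L]_(m, n)) (N : X -> 'M[L]_(n, p)) :
  mxregular M -> mxregular N -> mxregular (fun x => M x *m N x).
Proof.
move=> rM rN i j.
apply: (@regular_eq (fun x => \sum_k M x i k * N x k j)).
  by move=> x _; rewrite mxE.
by apply: regular_sum => k _; apply: regularM.
Qed.

Lemma mxregularXn n (M : X -> 'M[L]_n) k :
  mxregular M -> mxregular (fun x => M x ^+ k).
Proof.
move=> rM; elim: k => [|k IH]; first exact: mxregular_cst.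
by apply: mxregular_eq (mxregularM rM IH) => x _; rewrite exprS.
Qed.

Lemma regular_det n (M : X -> 'M[L]_n) :
  mxregular M -> reg (fun x => \det (M x)).
Proof.
move=> rM; rewrite /determinant; apply: regular_sum => s _; apply: regularM; first exact: regular_cst.
by apply: regular_prod => i _; apply: rM.
Qed.

Lemma mxregular_adj n (M : X -> 'M[L]_n) :
  mxregular M -> mxregular (fun x => \adj (M x)).
Proof.
move=> rM i j; apply: (@regular_eq (fun x => cofactor (M x) j i)).
  by move=> x _; rewrite mxE.
rewrite /cofactor; apply: regularM; first exact: regular_cst.
apply: (@regular_det _ (fun x => row' j (col' i (M x)))) => a b.
by apply: regular_eq (rM (lift j a) (lift i b)) => x _; rewrite !mxE.
Qed.

Lemma mxregularV n (M : X -> 'M[L]_n) :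
  (forall x, U x -> M x \in unitmx) ->
  mxregular M -> mxregular (fun x => invmx (M x)).
Proof.
move=> uM rM i j.
apply: (@regular_eq (fun x => (\det (M x))^-1 * (\adj (M x)) i j)).
  by move=> x Ux; rewrite /invmx uM // [in RHS]mxE.
apply: regularM; last exact: mxregular_adj.
apply: regularV (regular_det rM) => x Ux.
by have := uM x Ux; rewrite unitmxE unitfE.
Qed.

Lemma mxregular_row_mx m n p (M : X -> 'M[L]_(m, n)) (N : X -> 'M[L]_(m, p)) :
  mxregular M -> mxregular N -> mxregular (fun x => row_mx (M x) (N x)).
Proof.
move=> rM rN i j; case: (split_ordP j) => k ->.
  by apply: regular_eq (rM i k) => x _; rewrite row_mxEl.
by apply: regular_eq (rN i k) => x _; rewrite row_mxEr.
Qed.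

Lemma mxregular_col_mx m n p (M : X -> 'M[L]_(m, n)) (N : X -> 'M[L]_(p, n)) :
  mxregular M -> mxregular N -> mxregular (fun x => col_mx (M x) (N x)).
Proof.
move=> rM rN i j; case: (split_ordP i) => k ->.
  by apply: regular_eq (rM k j) => x _; rewrite col_mxEu.
by apply: regular_eq (rN k j) => x _; rewrite col_mxEd.
Qed.

Lemma mxregular_mxvec m n (M : X -> 'M[L]_(m, n)) :
  mxregular M -> mxregular (fun x => mxvec (M x)).
Proof.
move=> rM i j; rewrite (ord1 i); case/mxvec_indexP: j => a b.
by apply: regular_eq (rM a b) => x _; rewrite mxvecE.
Qed.

End Closure.

(** Substituting regular functions in a fraction yields a fraction of regular
    functions whose denominator does not vanish. *)
Lemma regular_comp (X X' : Type) D D' (t : X -> 'I_D -> L) (t' : X' -> 'I_D' -> L)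
  (U : set X) (U' : set X') (phi : X -> X') (h : X' -> L) :
  (forall x, U x -> U' (phi x)) ->
  (forall i, regular t U (fun x => t' (phi x) i)) ->
  regular t' U' h -> regular t U (fun x => h (phi x)).
Proof.
move=> sU tr [p [q pq]].
apply: (@regular_eq _ _ _ _ (fun x => p.@[t' (phi x)] * (q.@[t' (phi x)])^-1)).
  by move=> x /sU /pq[].
apply: regularM; first exact: regular_meval.
by apply: regularV; [move=> x /sU /pq[] | apply: regular_meval].
Qed.

(** Degree bounds that are additive, with the zero polynomial allowed. *)
Let degb D (p : {mpoly L[D]}) k := (msize p <= k.+1)%N.

Let degb_mul D (p q : {mpoly L[D]}) k l : degb p k -> degb q l -> degb (p * q) (k + l).
Proof.
rewrite /degb => pk ql; have [->|p0] := eqVneq p 0; first by rewrite mul0r msize0.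
have [->|q0] := eqVneq q 0; first by rewrite mulr0 msize0.
rewrite msizeM // -subn1 leq_subLR; apply: leq_trans (leq_add pk ql) _.
by rewrite addSn addnS add1n.
Qed.

Let degb_exp D (p : {mpoly L[D]}) k n : degb p k -> degb (p ^+ n) (k * n).
Proof.
move=> pk; elim: n => [|n IH]; first by rewrite /degb expr0 msize1.
by rewrite exprS mulnS; apply: degb_mul.
Qed.

Let degb_prod D (I : Type) (r : seq I) (F : I -> {mpoly L[D]}) (k : I -> nat) :
  (forall i, degb (F i) (k i)) -> degb (\prod_(i <- r) F i) (\sum_(i <- r) k i).
Proof.
move=> Fk; elim: r => [|i r IH]; first by rewrite !big_nil /degb msize1.
by rewrite !big_cons; apply: degb_mul.
Qed.

Let expn_growth K D : exists m, ((K * m).+1 ^ D < m ^ D.+1)%N.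
Proof.
pose m := (K.+1 ^ D).+1; exists m.
apply: (@leq_ltn_trans ((K.+1 * m) ^ D)).
  have [->|D0] := posnP D; first by rewrite !expn0.
  by rewrite leq_exp2r // mulSn addnC -addn1 leq_add2l.
by rewrite expnMn expnS ltn_pmul2r ?expn_gt0.
Qed.

Lemma kernel_vector m n (C : 'M[L]_(m, n)) :
  (n < m)%N -> exists2 u : 'rV[L]_m, u != 0 & u *m C = 0.
Proof.
move=> lt_nm; have : kermx C != 0.
  by rewrite -mxrank_eq0 mxrank_ker -lt0n subn_gt0 (leq_ltn_trans (rank_leq_col C)).
by case/rowV0Pn => u /sub_kermxP uC u0; exists u.
Qed.

(** A count of monomials. After multiplication by a power of a common
    denominator Q, the products of powers h i ^ a i with a i < m become
    polynomials of degree at most a constant times m in D variables. There are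
    m ^ D.+1 of them in a space of dimension O(m ^ D), so they are linearly
    dependent as soon as m is large. *)
Lemma regular_dependent (X : Type) D (t : X -> 'I_D -> L) (U : set X)
  (h : 'I_D.+1 -> X -> L) :
  (forall i, regular t U (h i)) ->
  exists2 P : {mpoly L[D.+1]}, P != 0 & forall x, U x -> P.@[h^~ x] = 0.
Proof.
move=> /fin_all_exists[p] /fin_all_exists[q pq].
pose Q := \prod_i q i; pose r i := p i * \prod_(j | j != i) q j.
have Q0 x : U x -> Q.@[t x] != 0.
  by move=> Ux; rewrite rmorph_prod; apply/prodf_neq0 => i _; case: (pq i x Ux).
have hQ i x : U x -> h i x * Q.@[t x] = (r i).@[t x].
  move=> Ux; have [q0 ->] := pq i x Ux.
  by rewrite /Q (bigD1 i) //= !mevalM mulrA divfK.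
pose e := (msize Q + \max_i msize (r i))%N.
have Qe : degb Q e by rewrite /degb ltnW // ltnS leq_addr.
have re i : degb (r i) e.
  rewrite /degb /e; apply: leqW; apply: leq_trans (leq_addl _ _).
  exact: leq_bigmax.
have [m lt_m] := expn_growth (D.+1 * e) D.
(* the monomial a in the h i, cleared of denominators by Q ^+ (D.+1 * m) *)
pose G (a : {ffun 'I_D.+1 -> 'I_m}) := \prod_i (r i ^+ a i * Q ^+ (m - a i)).
have Ge a : degb (G a) (D.+1 * e * m).
  have -> : (D.+1 * e * m = \sum_(i < D.+1) e * m)%N.
    by rewrite sum_nat_const card_ord mulnA.
  apply: degb_prod => i; have -> : (e * m = e * a i + e * (m - a i))%N.
    by rewrite -mulnDr subnKC // ltnW.
  by apply: degb_mul; apply: degb_exp.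
set M := (D.+1 * e * m).+1 in lt_m *.
pose A := {ffun 'I_D.+1 -> 'I_m}; pose B := {ffun 'I_D -> 'I_M}.
pose monA (a : A) := [multinom val (a i) | i < D.+1].
pose monB (b : B) := [multinom val (b i) | i < D].
have [u u0 uC] : exists2 u : 'rV[L]_#|A|, u != 0 &
    u *m (\matrix_(i, j) (G (enum_val i))@_(monB (enum_val j)) : 'M[L]_(#|A|, #|B|)) = 0.
  by apply: kernel_vector; rewrite !card_ffun !card_ord.
have uG : \sum_i u 0 i *: G (enum_val i) = 0.
  apply/mpolyP => k; rewrite mcoeff0 raddf_sum /=.
  have [/forallP kM|] := boolP [forall i, k i < M]%N.
    pose b : B := [ffun i => Ordinal (kM i)].
    have := congr1 (fun C : 'rV_#|B| => C 0 (enum_rank b)) uC.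
    rewrite !mxE => uCb; rewrite -[RHS]uCb; apply: eq_bigr => i _.
    rewrite mcoeffZ mxE enum_rankK; congr (_ * _@__).
    by apply/mnmP => j; rewrite mnmE ffunE.
  rewrite negb_forall => /existsP[j]; rewrite -leqNgt => Mk.
  rewrite big1 // => i _; rewrite mcoeffZ memN_msupp_eq0 ?mulr0 //.
  apply: msize_mdeg_ge; apply: leq_trans (Ge _) (leq_trans Mk _).
  by rewrite mdegE (bigD1 j) //= leq_addr.
exists (\sum_i u 0 i *: 'X_[monA (enum_val i)]).
  have /rV0Pn[i ui] := u0; apply: contraNneq ui => P0.
  have := congr1 (mcoeff (monA (enum_val i))) P0.
  rewrite mcoeff0 raddf_sum /= (bigD1 i) //= mcoeffZ mcoeffX eqxx mulr1.
  rewrite big1 ?addr0 => [->//|j ji]; rewrite mcoeffZ mcoeffX.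
  case: eqP => [E|]; last by rewrite mulr0.
  case/eqP: ji; apply: enum_val_inj; apply/ffunP => k; apply: val_inj.
  by have /mnmP/(_ k) := E; rewrite !mnmE.
move=> x Ux; apply: (mulIf (expf_neq0 (D.+1 * m) (Q0 x Ux))); rewrite mul0r.
have <- : (\sum_i u 0 i *: G (enum_val i)).@[t x] = 0 by rewrite uG meval0.
rewrite !raddf_sum mulr_suml; apply: eq_bigr => i _ /=.
rewrite !mevalZ -mulrA mevalX; congr (_ * _).
have -> : (D.+1 * m = \sum_(i < D.+1) m)%N by rewrite sum_nat_const card_ord.
rewrite expr_sum -big_split [RHS]rmorph_prod /=; apply: eq_bigr => j _.
rewrite mevalM !rmorphXn /= -hQ // exprMn -mulrA mnmE -exprD subnKC //.
exact: ltnW.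
Qed.
End RegularFunctions.

(** * Pairs of matrices with commutator a power of the first *)

Section CommutatorSet.
Variable L : closedFieldType.

Definition commutator_set n a : set ('M[L]_n * 'M[L]_n) :=
  [set AB | AB.1 *m AB.2 - AB.2 *m AB.1 = AB.1 ^+ a.+1].

Lemma mxexpS n (A : 'M[L]_n) k : A ^+ k.+1 = A *m A ^+ k.
Proof. exact: exprS. Qed.

Lemma mxexpSr n (A : 'M[L]_n) k : A ^+ k.+1 = A ^+ k *m A.
Proof. exact: exprSr. Qed.

(** If A were invertible, V := A^-(a+1) would commute with A, so that
    V (AB - BA) would have trace 0, whereas it is the identity matrix. *)
Lemma commutator_set_singular n a (A B : 'M[L]_n) :
  n%:R != 0 :> L -> commutator_set a (A, B) -> A \notin unitmx.
Proof.
move=> n0 /= AB; apply/negP => uA; move/negP: n0; apply.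
pose V := invmx A ^+ a.+1.
have VA : A *m V = V *m A.
  by apply: (commrX (R := 'M[L]_n)); apply: etrans (mulmxV uA) (esym (mulVmx uA)).
have V1 : V *m A ^+ a.+1 = 1%:M.
  rewrite /V; elim: a.+1 => [|k IH]; first by rewrite !expr0 mulmx1.
  rewrite (mxexpSr (invmx A)) (mxexpS A) -mulmxA (mulmxA (invmx A)) mulVmx // mul1mx.
  exact: IH.
apply/eqP; rewrite -(mxtrace1 L n) -V1 -AB mulmxBr raddfB /= !mulmxA.
rewrite (mxtrace_mulC (V *m B)) mulmxA.
by rewrite VA subrr.
Qed.

(** Steinitz: the indices of a maximal free set of rows of the cokernel of M
    select standard basis vectors spanning a complement of the row space of M.
    Only finitely many complements are thus ever needed. *)
Lemma complete_basis m n p (M : 'M[L]_(m, n)) :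
  (p + \rank M = n)%N ->
  exists e : {ffun 'I_p -> 'I_n}, (1%:M <= M + rowsub e 1%:M)%MS.
Proof.
move=> pE; have rk : \rank (cokermx M) = p by rewrite mxrank_coker; apply: (canLR (addnK _)).
pose f := maxrankfun (cokermx M); have frf := maxrowsub_free (cokermx M).
rewrite -/f in frf; move: f frf; rewrite rk => f frf.
exists f; set E := rowsub f 1%:M.
have EC : E *m cokermx M = rowsub f (cokermx M) by rewrite mul_rowsub_mx mul1mx.
rewrite sub1mx; apply/eqP; rewrite mxrank_disjoint_sum.
  have -> : \rank E = p.
    apply/eqP; rewrite eqn_leq rank_leq_row /=.
    by rewrite -[X in (X <= _)%N](eqP frf) -EC mxrankM_maxl.
  by rewrite addnC.
apply/eqP/rowV0P => v; rewrite sub_capmx => /andP[vM /submxP[w wE]].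
have : v *m cokermx M = 0 by apply/eqP; rewrite -submxE.
rewrite wE -mulmxA EC => /(congr1 (mulmx^~ (pinvmx (rowsub f (cokermx M))))).
by rewrite mul0mx mulmxKp // => ->; rewrite mul0mx.
Qed.

Lemma block_exp k r a (X : 'M[L]_(r, k)) (A : 'M[L]_r) :
  (block_mx 0 0 X A : 'M_(k + r)) ^+ a.+1 =
  block_mx 0 0 (A ^+ a *m X) (A ^+ a.+1).
Proof.
elim: a => [|a IH]; first by rewrite !expr1 expr0 mul1mx.
rewrite mxexpS IH mulmx_block !mul0mx !mulmx0 !addr0 !add0r.
by rewrite mulmxA -!mxexpS.
Qed.

(** Coordinates on the pairs (A, B) with A of rank r. The left kernel of A is
    stable under B, and in a basis g whose first k vectors span this kernel the
    matrices become [[0, 0], [X, A']] and [[P, 0], [Q, B']], where (A', B')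
    satisfies the same equation in size r and
    [X A'] [P; Q] = A'^a X + B' X.
    As [X A'] has independent rows, this linear system determines C = [P; Q]
    once the k rows of C selected by e3 are given; they form the matrix F. The
    basis g is determined by the kernel, up to the choice of a chart (e1, e2)
    of the Grassmannian in which the kernel is the graph of Y. The number of
    parameters is k r (for Y) + r k (for X) + k^2 (for F) + r^2 (for AB, by
    recursion), that is (k + r)^2. *)
Definition chart k r a (e1 : {ffun 'I_r -> 'I_(k + r)})
  (e2 e3 : {ffun 'I_k -> 'I_(k + r)}) (Y : 'M[L]_(k, r)) (X : 'M[L]_(r, k))
  (F : 'M[L]_k) (AB : 'M[L]_r * 'M[L]_r) : 'M[L]_(k + r) * 'M[L]_(k + r) :=
  let g := block_mx 1%:M Y 0 1%:M *m col_mx (rowsub e2 1%:M) (rowsub e1 1%:M) in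
  let C := invmx (col_mx (rowsub e3 1%:M) (row_mx X AB.1)) *m
           col_mx F (AB.1 ^+ a *m X + AB.2 *m X) in
  (invmx g *m block_mx 0 0 X AB.1 *m g,
   invmx g *m block_mx (usubmx C) 0 (dsubmx C) AB.2 *m g).

Lemma conj_exp n (g A : 'M[L]_n) a : g \in unitmx ->
  (g *m A *m invmx g) ^+ a.+1 = g *m A ^+ a.+1 *m invmx g.
Proof.
move=> ug; elim: a => [//|a IH].
by rewrite mxexpS IH (mxexpS A a.+1) !mulmxA mulmxKV.
Qed.

Lemma chart_surj k r a (A B : 'M[L]_(k + r)) :
  commutator_set a (A, B) -> \rank A = r ->
  exists (e1 : {ffun 'I_r -> 'I_(k + r)}) (e2 e3 : {ffun 'I_k -> 'I_(k + r)})
    Y X F AB, [/\ commutator_set a AB,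
    col_mx (rowsub e2 1%:M) (rowsub e1 1%:M) \in @unitmx L _,
    col_mx (rowsub e3 1%:M) (row_mx X AB.1) \in unitmx &
    @chart k r a e1 e2 e3 Y X F AB = (A, B)].
Proof.
move=> /= AB rA.
(* K: a basis of the left kernel of A; E1: standard vectors completing it;
   E2: standard vectors completing E1, so that K has coordinates (Y1, Y2) in
   the basis h = (E2, E1), with Y1 invertible *)
have [K KA rK] : exists2 K : 'M_(k, k + r), K *m A = 0 & \rank K = k.
  have rk : \rank (kermx A) = k by rewrite mxrank_ker rA addnK.
  have : row_base (kermx A) *m A = 0 by apply/sub_kermxP; rewrite eq_row_base.
  have : \rank (row_base (kermx A)) = k by rewrite eq_row_base.
  by move: (row_base _); rewrite rk => K rK KA; exists K.
have [e1 e1P] := @complete_basis _ _ r K (etrans (addnC _ _) (congr1 (addn^~ r) rK)).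
have rE1 : \rank (rowsub e1 1%:M : 'M[L]_(r, k + r)) = r.
  apply/eqP; rewrite eqn_leq rank_leq_row -(leq_add2l k) -[X in (X + _ <= _)%N]rK.
  have := leq_trans (mxrankS e1P) (mxrank_adds_leqif _ _).
  by rewrite mxrank1 rK.
have [e2 e2P] := @complete_basis _ _ k (rowsub e1 1%:M : 'M[L]_(r, k + r)) (congr1 (addn k) rE1).
set E1 := rowsub e1 1%:M in e1P e2P rE1; set E2 := rowsub e2 1%:M in e2P.
set h : 'M_(k + r) := col_mx E2 E1.
have uh : h \in unitmx by rewrite -row_full_unit -sub1mx -addsmxE addsmxC.
pose Y1 := lsubmx (K *m invmx h); pose Y2 := rsubmx (K *m invmx h).
have KE : K = row_mx Y1 Y2 *m h by rewrite hsubmxK mulmxKV.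
have E1E : E1 = row_mx 0 1%:M *m h by rewrite mul_row_col mul0mx mul1mx add0r.
have uY1 : Y1 \in unitmx.
  have : col_mx K E1 \in unitmx by rewrite -row_full_unit -sub1mx -addsmxE.
  rewrite [in X in _ X]KE E1E -mul_col_mx unitmx_mul => /andP[+ _].
  by rewrite -/(block_mx Y1 Y2 0 1%:M) unitmxE det_ublock det1 mulr1 -unitmxE.
pose Y := invmx Y1 *m Y2.
have [g gdef] : {g | g = block_mx 1%:M Y 0 1%:M *m h} by eexists.
have ug : g \in unitmx.
  by rewrite gdef unitmx_mul uh andbT unitmxE det_ublock !det1 mulr1 unitr1.
have gE : g = col_mx (invmx Y1 *m K) E1.
  by rewrite gdef KE E1E mulmxA mul_mx_row mulVmx // -mul_col_mx.
pose At := g *m A *m invmx g; pose Bt := g *m B *m invmx g.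
have ABt : At *m Bt - Bt *m At = At ^+ a.+1.
  rewrite conj_exp // -AB mulmxBr mulmxBl /At /Bt !mulmxA.
  by rewrite !(mulmxKV ug).
have uAt : usubmx At = 0.
  by rewrite /At {1}gE !mul_col_mx col_mxKu -(mulmxA _ K) KA mulmx0 mul0mx.
pose X := dlsubmx At; pose A' := drsubmx At.
have AtE : At = block_mx 0 0 X A'.
  rewrite -[At]submxK; congr block_mx; rewrite /ulsubmx /ursubmx uAt;
  by apply/matrixP => i j; rewrite !mxE.
pose B' := drsubmx Bt; pose P := ulsubmx Bt; pose Q := dlsubmx Bt; pose R := ursubmx Bt.
have BtE : Bt = block_mx P R Q B' by rewrite submxK.
have rN : \rank (row_mx X A') = r.
  have : \rank At = r.
    by rewrite /At mxrankMfree ?row_free_unit ?unitmx_inv // eqmxMfull ?row_full_unit.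
  by rewrite AtE /block_mx row_mx0 -addsmxE adds0mx.
have := ABt; rewrite AtE BtE block_exp !mulmx_block opp_block_mx add_block_mx.
rewrite !mul0mx !mulmx0 !add0r.
case/eq_block_mx => RX RA eqX eqA.
(* the left kernel of A, spanned by the first k basis vectors, is B-stable *)
have R0 : R = 0.
  have : R *m row_mx X A' = 0.
    by rewrite mul_mx_row -[R *m X]opprK RX -[R *m A']opprK RA !oppr0 row_mx0.
  move/(congr1 (mulmx^~ (pinvmx (row_mx X A')))).
  by rewrite mul0mx mulmxKp // /row_free rN.
rewrite R0 mulmx0 add0r in eqA; rewrite R0 in BtE.
have [e3 e3P] := @complete_basis _ _ k (row_mx X A') (congr1 (addn k) rN).
set E3 := rowsub e3 1%:M in e3P.
have u3 : col_mx E3 (row_mx X A') \in unitmx.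
  by rewrite -row_full_unit -sub1mx -addsmxE addsmxC.
exists e1, e2, e3, Y, X, (E3 *m col_mx P Q), (A', B'); split=> //.
have -> : (A, B) = (invmx g *m At *m g, invmx g *m Bt *m g).
  by rewrite /At /Bt !mulmxA !mulVmx // !mul1mx !mulmxKV.
rewrite /chart -/E1 -/E2 -/h -gdef AtE BtE /=.
have -> : A' ^+ a *m X + B' *m X = row_mx X A' *m col_mx P Q.
  by rewrite mul_row_col -eqX subrK.
by rewrite -mul_col_mx mulKmx // col_mxKu col_mxKd.
Qed.
End CommutatorSet.

Section RationalCover.
Variable L : closedFieldType.

(** W is contained in finitely many images of subsets of affine D-space under
    rational maps, whose denominators do not vanish on the sets U j. *)
Definition rationally_covered D n (W : set ('M[L]_n * 'M[L]_n)) :=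
  exists (J : finType) (U : J -> set ('I_D -> L))
    (phi : J -> ('I_D -> L) -> 'M[L]_n * 'M[L]_n),
  (forall j, mxregular id (U j) (fun x => (phi j x).1) /\
             mxregular id (U j) (fun x => (phi j x).2)) /\
  forall w, W w -> exists j x, U j x /\ phi j x = w.

Lemma rationally_covered_bigcup D n (J : finType)
    (W : set ('M[L]_n * 'M[L]_n)) (V : J -> set ('M[L]_n * 'M[L]_n)) :
  (forall w, W w -> exists j, V j w) ->
  (forall j, rationally_covered D (V j)) -> rationally_covered D W.
Proof.
move=> WV /fin_all_exists[I] /fin_all_exists[U] /fin_all_exists[phi] covV.
exists {j : J & I j}, (fun i => U (tag i) (tagged i)), (fun i => phi (tag i) (tagged i)).
split=> [[j i]|w /WV[j /(covV j).2[i [x Ux]]]]; first exact: (covV j).1.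
by exists (Tagged I i), x.
Qed.

(** The charts of rank r pairs turn a covering of the solutions of size r into
    one of the rank r solutions of size k + r, with the number of parameters
    growing from r^2 to (k + r)^2. *)
Lemma cover_rank_stratum k r a :
  rationally_covered (r ^ 2) (@commutator_set L r a) ->
  rationally_covered ((k + r) ^ 2)
    [set AB : 'M[L]_(k + r) * 'M[L]_(k + r) | commutator_set a AB /\ \rank AB.1 = r].
Proof.
case=> J [U [phi [phir cov]]].
pose I : finType := ('I_k * 'I_r + 'I_r * 'I_k + 'I_k * 'I_k + 'I_(r ^ 2))%type.
have cI : #|I| = ((k + r) ^ 2)%N.
  by rewrite !card_sum !card_prod !card_ord -!mulnn mulnDl !mulnDr; lia.
pose pos (i : I) := cast_ord cI (enum_rank i).
pose X x := \matrix_(i < r, j < k) (x (pos (inl (inl (inr (i, j))))) : L).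
pose Y x := \matrix_(i < k, j < r) (x (pos (inl (inl (inl (i, j))))) : L).
pose F x := \matrix_(i < k, j < k) (x (pos (inl (inr (i, j)))) : L).
pose sub (x : 'I_((k + r) ^ 2) -> L) (i : 'I_(r ^ 2)) := x (pos (inr i)).
pose N j x := row_mx (X x) (phi j (sub x)).1.
pose E m := {ffun 'I_m -> 'I_(k + r)}; exists (E r * E k * E k * J)%type.
exists (fun (c : E r * E k * E k * J) => let: (e1, e2, e3, j) := c in
  [set x | [/\ U j (sub x), col_mx (rowsub e2 1%:M) (rowsub e1 1%:M) \in @unitmx L _
    & col_mx (rowsub e3 1%:M) (N j x) \in unitmx]]).
exists (fun (c : E r * E k * E k * J) x => let: (e1, e2, e3, j) := c in
  chart a e1 e2 e3 (Y x) (X x) (F x) (phi j (sub x))).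
split=> [[[[e1 e2] e3] j]|[A B] [/= TAB rA]].
  set U' := [set x | _].
  have [r1 r2] : mxregular id U' (fun x => (phi j (sub x)).1) /\
                 mxregular id U' (fun x => (phi j (sub x)).2).
    split=> s t.
      apply: (regular_comp _ _ ((phir j).1 s t)) => [x []//|i].
      exact: (@regular_coord _ _ _ id).
    apply: (regular_comp _ _ ((phir j).2 s t)) => [x []//|i].
    exact: (@regular_coord _ _ _ id).
  have rX : mxregular id U' X.
    move=> s t; apply: regular_eq (regular_coord id U' (pos (inl (inl (inr (s, t)))))).
    by move=> x _; rewrite mxE.
  have rY : mxregular id U' Y.
    move=> s t; apply: regular_eq (regular_coord id U' (pos (inl (inl (inl (s, t)))))).
    by move=> x _; rewrite mxE.
  have rF : mxregular id U' F.
    move=> s t; apply: regular_eq (regular_coord id U' (pos (inl (inr (s, t))))).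
    by move=> x _; rewrite mxE.
  pose h : 'M[L]_(k + r) := col_mx (rowsub e2 1%:M) (rowsub e1 1%:M).
  pose g x : 'M[L]_(k + r) := block_mx 1%:M (Y x) 0 1%:M *m h.
  have rg : mxregular id U' g.
    apply: mxregularM; last exact: mxregular_cst.
    apply: mxregular_col_mx; last exact: mxregular_cst.
    by apply: mxregular_row_mx => //; apply: mxregular_cst.
  have rgV : mxregular id U' (fun x => invmx (g x)).
    apply: mxregularV => // x [_ uh _].
    by rewrite unitmx_mul uh andbT unitmxE det_ublock !det1 mulr1 unitr1.
  pose C x := invmx (col_mx (rowsub e3 1%:M) (N j x)) *m
    col_mx (F x) ((phi j (sub x)).1 ^+ a *m X x + (phi j (sub x)).2 *m X x).
  have rC : mxregular id U' C.
    apply: mxregularM.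
      apply: mxregularV => [x []//|].
      by apply: mxregular_col_mx; [apply: mxregular_cst | apply: mxregular_row_mx].
    apply: mxregular_col_mx => //; apply: mxregularD; apply: mxregularM => //.
    exact: mxregularXn.
  split; apply: mxregularM => //; apply: mxregularM => //.
    apply: mxregular_col_mx; first exact: mxregular_cst.
    exact: mxregular_row_mx.
  apply: mxregular_col_mx; apply: mxregular_row_mx => //.
  - by move=> s t; apply: regular_eq (rC (lshift r s) t) => x _; rewrite [in RHS]mxE.
  - exact: mxregular_cst.
  - by move=> s t; apply: regular_eq (rC (rshift k s) t) => x _; rewrite [in RHS]mxE.
have [e1 [e2 [e3 [Y0 [X0 [F0 [AB0 [TAB0 u1 u2 chE]]]]]]]] := chart_surj TAB rA.
have [j [x0 [Ux0 phx0]]] := cov _ TAB0.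
pose y (i : I) := match i with
  | inl (inl (inl (i, j))) => Y0 i j | inl (inl (inr (i, j))) => X0 i j
  | inl (inr (i, j)) => F0 i j | inr i => x0 i end.
pose x i := y (enum_val (cast_ord (esym cI) i)).
have xpos i : x (pos i) = y i by rewrite /x /pos cast_ordK enum_rankK.
have YE : Y x = Y0 by apply/matrixP => s t; rewrite mxE xpos.
have XE : X x = X0 by apply/matrixP => s t; rewrite mxE xpos.
have FE : F x = F0 by apply/matrixP => s t; rewrite mxE xpos.
have xE : sub x = x0 by apply/funext => s; rewrite /sub xpos.
exists (e1, e2, e3, j), x; rewrite /= /N YE XE FE xE phx0; split=> //.
Qed.

(** Strong induction on the size, through the rank of A, which cannot be full. *)
Lemma commutator_set_covered n a :
  (forall m, (0 < m <= n)%N -> m%:R != 0 :> L) ->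
  rationally_covered (n ^ 2) (@commutator_set L n a).
Proof.
elim/ltn_ind: n => n IH n0.
have [E|n_gt0] := posnP n.
  rewrite E in IH n0 *; exists unit, (fun=> setT), (fun _ _ => (0, 0)).
  split=> [_|[A B] _]; first by split; apply: mxregular_cst.
  by exists tt, (fun=> 0); split=> //; rewrite (flatmx0 A) (flatmx0 B).
apply: (@rationally_covered_bigcup _ _ 'I_n _
  (fun r => [set AB : 'M[L]_n * 'M[L]_n | commutator_set a AB /\ \rank AB.1 = r])).
  move=> [A B] TAB; have : A \notin unitmx.
    by apply: commutator_set_singular TAB; rewrite n0 // n_gt0 leqnn.
  rewrite -row_free_unit /row_free => rA.
  have lt_rA : (\rank A < n)%N by rewrite ltn_neqAle rA rank_leq_row.
  by exists (Ordinal lt_rA).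
move=> [r lt_rn] /=; have {IH} IH := IH r lt_rn.
have [k nE] : exists k, n = (k + r)%N.
  by exists (n - r)%N; rewrite subnK // ltnW.
move: n0 => {n_gt0 lt_rn}; rewrite {n}nE in IH * => n0.
apply: cover_rank_stratum; apply: IH => m /andP[m0 le_mr].
by apply: n0; rewrite m0 (leq_trans le_mr) ?leq_addl.
Qed.

End RationalCover.

(** * The upper bound *)

Section UpperBound.
Variable L : closedFieldType.

(** Over an algebraically closed field the characteristic polynomial splits, and
    every root is an eigenvalue of a nilpotent matrix, hence zero. *)
Lemma nilpotent_char_poly n (B : 'M[L]_n) :
  nilpotent_mx B -> char_poly B = 'X^n.
Proof.
case=> k Bk.
have root0 z : root (char_poly B) z -> z = 0.
  rewrite -eigenvalue_root_char => /eigenvalueP[v vB v0].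
  have vBj j : v *m B ^+ j = z ^+ j *: v.
    elim: j => [|j IH]; first by rewrite !expr0 mulmx1 scale1r.
    by rewrite mxexpSr mulmxA IH -scalemxAl vB scalerA exprSr.
  have := vBj k; rewrite Bk mulmx0 => /esym/eqP.
  by rewrite scaler_eq0 (negPf v0) orbF expf_eq0 => /andP[_ /eqP].
have [s sE] := closed_field_poly_normal (char_poly B).
move: sE; rewrite (monicP (char_poly_monic B)) scale1r => sE.
have charE : char_poly B = 'X^(size s).
  rewrite sE big_seq (eq_bigr (fun=> 'X)) => [|z zs].
    by rewrite -big_seq big_const_seq count_predT iter_mulr_1.
  by rewrite (root0 z) ?subr0 // sE root_prod_XsubC.
by have := size_char_poly B; rewrite charE size_polyXn => -[->].
Qed.

Lemma nilpotent_trace n (B : 'M[L]_n) : nilpotent_mx B -> \tr B = 0.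
Proof.
case: n B => [|n] B nB; first by rewrite /mxtrace big_ord0.
apply: oppr_inj; rewrite oppr0 -char_poly_trace // nilpotent_char_poly //.
by rewrite coefXn ltn_eqF.
Qed.

(** One relation on each of the finitely many pieces: their product is a relation
    on W. *)
Lemma covered_dependent D n (W : set ('M[L]_n * 'M[L]_n))
  (f : nat -> 'M[L]_n * 'M[L]_n -> L) :
  (forall i U phi, mxregular id U (fun x : 'I_D -> L => (phi x).1) ->
     mxregular id U (fun x => (phi x).2) -> regular id U (f i \o phi)) ->
  rationally_covered D W -> ~ alg_indep W D.+1 f.
Proof.
move=> fr [J [U [phi [phir cov]]]] ind.
have dep j : exists P : {mpoly L[D.+1]}, P != 0 /\
    forall x, U j x -> P.@[fun i : 'I_D.+1 => f i (phi j x)] = 0.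
  have [|P P0 PE] := @regular_dependent L _ _ id (U j) (fun i => f i \o phi j).
    by move=> i; apply: fr; case: (phir j).
  by exists P.
have [P PP] := fin_all_exists dep.
suff : \prod_j P j = 0.
  by apply/eqP/prodf_neq0 => j _; case: (PP j).
apply: ind => w /cov[j [x [Ujx <-]]].
by rewrite rmorph_prod (bigD1 j) //= (PP j).2 ?mul0r.
Qed.

(** A chain of length n^2 would give n^2 independent functions p i. Adding
    scalar matrices to B preserves the equation and breaks nilpotency: the
    solutions of the equation contain a copy of the locus times the affine
    line, the coordinate of the line being tr B / n. So tr B / n and the values
    of the p i at (A, B - tr B / n) would be n^2 + 1 independent functions on a
    set covered by images of affine n^2-space. *)
Lemma chain_length_Sset n a d Z :
  (0 < n)%N -> (forall m, (0 < m <= n)%N -> m%:R != 0 :> L) ->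
  irreducible_chain (@pair_coords L n @` @Sset L n a.+1) d Z -> (d < n ^ 2)%N.
Proof.
move=> n_gt0 n0 [irrZ ltZ]; rewrite ltnNge; apply/negP => le_nd.
have [|p ind] := @chain_alg_indep L _ (@pair_coords L n @` @Sset L n a.+1) (n ^ 2) Z.
  split=> i i_le; first by apply: irrZ; apply: leq_trans le_nd.
  by apply: ltZ; apply: leq_trans le_nd.
pose c (AB : 'M[L]_n * 'M[L]_n) := \tr AB.2 / n%:R.
pose g i AB := if (i < n ^ 2)%N then
  (p i).@[pair_coords (AB.1, AB.2 - (c AB)%:M) ord0] else c AB.
have cr U phi : mxregular id U (fun x : 'I_(n ^ 2) -> L => (phi x).2) ->
    regular id U (c \o phi).
  move=> r2; apply: regularM; last exact: regular_cst.
  by apply: regular_sum => i _; apply: r2.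
apply: (covered_dependent (f := g) _ (@commutator_set_covered L n a n0)).
  move=> i U phi r1 r2; rewrite /g /comp; case: (i < n ^ 2)%N; last exact: cr.
  apply: regular_meval => k.
  apply: mxregular_row_mx; apply: mxregular_mxvec => //=.
  apply: mxregularD => // s t.
  apply: (@regular_eq _ _ _ _ _ (fun x => (- (s == t)%:R) * c (phi x))).
    by move=> x _; rewrite !mxE mulNr mulr_natl.
  by apply: regularM; [apply: regular_cst | apply: cr].
apply: alg_indep_line ind => w b Zw.
have [_ /(_ w Zw)[[A B] [/= nilB AB] <-]] := irrZ _ le_nd.
have cE : c (A, B + b%:M) = b.
  rewrite /c /= raddfD /= (nilpotent_trace nilB) add0r mxtrace_scalar.
  by rewrite -[b *+ n]mulr_natr mulfK // n0 // n_gt0 leqnn.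
exists (A, B + b%:M); split.
- rewrite /commutator_set /= -AB mulmxDr mulmxDl scalar_mxC.
  by rewrite opprD addrACA subrr addr0.
- by rewrite /g ltnn.
- by move=> i lt_in; rewrite /g lt_in cE /= addrK.
Qed.
End UpperBound.

(** * Chains from parametrizations *)

Section ParametrizedChains.
Variable L : closedFieldType.

(** One line at a time, as L is infinite. *)
Lemma mpoly_vanishing D (p : {mpoly L[D]}) :
  (forall x : 'I_D -> L, p.@[x] = 0) -> p = 0.
Proof.
move=> p0.
suff ind d : alg_indep [set: nat -> L] d (fun i x => x i) by apply: ind.
elim: d => [|d IH]; first by apply: alg_indep0; exists (fun=> 0) => //.
apply: alg_indep_line IH => x c _.
exists (fun i => if i == d then c else x i); split=> //; first by rewrite eqxx.
by move=> i lt_id; rewrite ltn_eqF.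
Qed.

Definition coords N (x : 'rV[L]_N) := x ord0.

(** On the whole affine space a fraction vanishes where its numerator does. *)
Lemma zariski_closed_regular N (T : Type) (h : T -> 'rV[L]_N -> L) :
  (forall i, regular (@coords N) setT (h i)) ->
  zariski_closed [set x | forall i, h i x = 0].
Proof.
move=> hr; exists [set p | exists i, forall x : 'rV[L]_N, h i x = 0 -> p.@[x ord0] = 0].
apply/seteqP; split=> x /= hx => [p [i]|i]; first by apply.
have [p [q pq]] := hr i; have [q0 hE] := pq x Logic.I.
rewrite hE hx ?mul0r //; exists i => {x hx q0 hE} x.
have [q0 ->] := pq x Logic.I; move/eqP.
by rewrite mulf_eq0 invr_eq0 (negPf q0) orbF => /eqP.
Qed.

Definition zariski_closure N (W : set 'rV[L]_N) :=
  zero_locus [set p : {mpoly L[N]} | forall w, W w -> p.@[w ord0] = 0].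

Lemma subset_closure N (W : set 'rV[L]_N) : W `<=` zariski_closure W.
Proof. by move=> w Ww p; apply. Qed.

Lemma closure_subset N (W V : set 'rV[L]_N) :
  zariski_closed V -> W `<=` V -> zariski_closure W `<=` V.
Proof. by case=> I -> WV x Wx p Ip; apply: Wx => w /WV; apply. Qed.

(** Let phi be a map given by fractions on the complement U of the hypersurface
    delta = 0, which does not contain the origin. The closures of the images of
    the coordinate subspaces are irreducible. They form a strictly increasing
    chain as soon as each parameter x k can be detected on the target: some
    function u vanishes wherever x k does, but not at some point whose only
    nonzero parameter is x k. *)
Section ParamChain.
Variables (D N : nat) (delta : ('I_D -> L) -> L) (phi : ('I_D -> L) -> 'rV[L]_N).
Hypothesis delta_reg : regular id setT delta.
Hypothesis delta0 : delta (fun=> 0) != 0.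
Let U := [set x | delta x != 0].
Hypothesis phi_reg : mxregular id U phi.

Let cell (t : seq 'I_D) : set 'rV[L]_N :=
  phi @` [set x | U x /\ forall k, k \notin t -> x k = 0].

(** Two polynomials whose product vanishes on the cell pull back to fractions
    whose product vanishes on an open subset of a coordinate subspace; since
    this subspace is irreducible, one of the two vanishes. *)
Let cell_irreducible t : irreducible_closed (zariski_closure (cell t)).
Proof.
split; first by eexists.
  exists (phi (fun=> 0)); apply: subset_closure; exists (fun=> 0) => //.
move=> Y Y' cY cY' E; apply: contrapT => /not_orP[nY nY'].
(* working with all parameters, through the projection onto the coordinate
   subspace, avoids polynomials in fewer variables *)
pose proj (x : 'I_D -> L) k := if k \in t then x k else 0.
have projr (V : set ('I_D -> L)) k : regular id V (fun x => proj x k).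
  by rewrite /proj; case: (k \in t); [apply: regular_coord | apply: regular_cst].
(* on the cell, a proper closed subset lies in the zero set of some polynomial
   whose pullback to the parameter space is nonzero *)
have pullback (Y0 : set 'rV[L]_N) : zariski_closed Y0 -> Y0 `<=` zariski_closure (cell t) ->
    zariski_closure (cell t) <> Y0 ->
    exists2 a : {mpoly L[D]}, a != 0 & forall x, U (proj x) -> Y0 (phi (proj x)) -> a.@[x] = 0.
  case=> J -> sJ nJ.
  have [p Jp [x [Ux xt] px]] : exists2 p, J p & exists2 x : 'I_D -> L,
      U x /\ (forall k, k \notin t -> x k = 0) & p.@[phi x ord0] != 0.
    apply: contrapT => nex; apply: nJ; apply/seteqP; split=> // z zW p Jp.
    apply: zW => _ [x xW <-]; apply/eqP/negPn/negP => px; apply: nex.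
    by exists p => //; exists x.
  have [|||a [b ab]] := @regular_comp L _ _ _ _ id (@coords N) [set x | U (proj x)] setT
      (fun x => phi (proj x)) (fun y => p.@[y ord0]).
  - by [].
  - move=> i; have := regular_comp (phi := proj) _ (projr [set x | U (proj x)]) (phi_reg ord0 i).
    by apply.
  - by apply: regular_meval => i; apply: (@regular_coord _ _ _ (@coords N)).
  have xE : proj x = x.
    by apply/funext => k; rewrite /proj; case: ifPn => // /xt.
  exists a.
    apply: contraNneq px => a0; have := ab x; rewrite /= xE => /(_ Ux)[_ ->].
    by rewrite a0 meval0 mul0r.
  move=> z Uz Jz; have [b0 /esym/eqP] := ab z Uz.
  by rewrite (Jz p Jp) mulf_eq0 invr_eq0 (negPf b0) orbF => /eqP.
have [|||a a0 aE] := pullback Y => //; first by rewrite E; left.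
have [|||a' a0' aE'] := pullback Y' => //; first by rewrite E; right.
have [c [d cd]] : regular id setT (fun x => delta (proj x)).
  exact: (regular_comp (phi := proj) (U' := setT) _ (projr setT) delta_reg).
have c0 : c != 0.
  apply: contraNneq delta0 => c0; have [_] := cd (fun=> 0) Logic.I.
  have -> : proj (fun=> 0) = fun=> 0 by apply/funext => k; rewrite /proj if_same.
  by rewrite c0 meval0 mul0r => ->.
have : a * a' * c = 0.
  apply: mpoly_vanishing => x; rewrite !mevalM.
  have [|cx] := eqVneq c.@[x] 0; first by move=> ->; rewrite mulr0.
  have Ux : U (proj x).
    by rewrite /U /=; have [d0 ->] := cd x Logic.I; rewrite mulf_neq0 ?invr_eq0.
  have : (Y `|` Y') (phi (proj x)).
    rewrite -E; apply: subset_closure; exists (proj x) => //; split=> // k kt.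
    by rewrite /proj (negPf kt).
  by case=> Yx; [rewrite aE | rewrite aE'] => //; rewrite ?(mul0r, mulr0).
by move/eqP; rewrite !mulf_eq0 (negPf a0) (negPf a0') (negPf c0).
Qed.

Lemma param_chain (V : set 'rV[L]_N) (s : seq 'I_D) :
  zariski_closed V -> (forall x, U x -> V (phi x)) -> uniq s ->
  (forall k, k \in s -> exists2 u, regular (@coords N) setT u &
     (forall x, U x -> x k = 0 -> u (phi x) = 0) /\
     exists2 x, U x & (forall l, l != k -> x l = 0) /\ u (phi x) != 0) ->
  exists Z, irreducible_chain V (size s) Z.
Proof.
move=> cV phiV us sep; exists (fun i => zariski_closure (cell (take i s))); split=> i lei.
  split; first exact: cell_irreducible.
  by apply: closure_subset => // _ [x [Ux _] <-]; apply: phiV.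
have [k0 _] : exists k : 'I_D, True by case: (s) lei => // k; exists k.
set k := nth k0 s i; have [u [p [q pq]] [u0 [x Ux [xk ux]]]] := sep k (mem_nth _ lei).
have p0 (y : 'rV[L]_N) : p.@[y ord0] = 0 <-> u y = 0.
  have [q0 ->] := pq y Logic.I; split=> [->|/eqP]; first by rewrite mul0r.
  by rewrite mulf_eq0 invr_eq0 (negPf q0) orbF => /eqP.
split.
  apply: closure_subset; first by eexists.
  move=> _ [y [Uy yt] <-]; apply: subset_closure; exists y => //; split=> // l lt.
  by apply: yt; apply: contra lt; rewrite (take_nth k0) // mem_rcons inE => ->; rewrite orbT.
move=> /(_ (phi x)) sub; move/eqP: ux; apply; apply/p0; apply: sub.
  apply: subset_closure; exists x => //; split=> // l.
  by rewrite (take_nth k0) // mem_rcons inE negb_or => /andP[lk _]; apply: xk.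
move=> _ [y [Uy yt] <-]; apply/p0; apply: u0 => //; apply: yt.
apply/negP => /(nthP k0)[j]; rewrite size_takel ?(ltnW lei) // => ltj.
rewrite nth_take // => /eqP; rewrite nth_uniq // ?(ltn_trans ltj) //.
by rewrite (ltn_eqF ltj).
Qed.
End ParamChain.
End ParametrizedChains.

(** * The nilpotent commutator locus is closed *)

Section ClosedLocus.
Variable L : closedFieldType.

(** The bound n on the exponent is what makes nilpotency a polynomial condition. *)
Lemma nilpotent_exp n (B : 'M[L]_n) : nilpotent_mx B -> B ^+ n = 0.
Proof.
case: n B => [|n] B nB; first by rewrite (flatmx0 (B ^+ 0)).
have := Cayley_Hamilton B; rewrite nilpotent_char_poly //.
by rewrite rmorphXn /= horner_mx_X.
Qed.

Lemma row_mxvecK m n p q (A : 'M[L]_(m, n)) (B : 'M[L]_(p, q)) :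
  (vec_mx (lsubmx (row_mx (mxvec A) (mxvec B))) = A) *
  (vec_mx (rsubmx (row_mx (mxvec A) (mxvec B))) = B).
Proof. by rewrite row_mxKl row_mxKr !mxvecK. Qed.

Definition mx1 n (x : 'rV[L]_(n * n + n * n)) : 'M[L]_n := vec_mx (lsubmx x).
Definition mx2 n (x : 'rV[L]_(n * n + n * n)) : 'M[L]_n := vec_mx (rsubmx x).

Lemma mx1_regular n U : mxregular (@coords L _) U (@mx1 n).
Proof.
move=> i j; apply: regular_eq (regular_coord (@coords L _) U (lshift _ (mxvec_index i j))).
by move=> x _; rewrite !mxE.
Qed.

Lemma mx2_regular n U : mxregular (@coords L _) U (@mx2 n).
Proof.
move=> i j; apply: regular_eq (regular_coord (@coords L _) U (rshift _ (mxvec_index i j))).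
by move=> x _; rewrite !mxE.
Qed.

Lemma Sset_closed n a : zariski_closed (@pair_coords L n @` @Sset L n a).
Proof.
pose F (x : 'rV[L]_(n * n + n * n)) : 'M[L]_n :=
  mx1 x *m mx2 x + (- 1%:M) *m (mx2 x *m mx1 x) + (- 1%:M) *m mx1 x ^+ a.
pose h (i : bool * 'I_n * 'I_n) x := (if i.1.1 then mx2 x ^+ n else F x) i.1.2 i.2.
have -> : @pair_coords L n @` @Sset L n a = [set x | forall i, h i x = 0].
  apply/seteqP; split=> x /=.
    case=> [[A B] /= [nB AB] <-] [[[] i] j]; rewrite /h /F /mx1 /mx2 /pair_coords /=.
      by rewrite row_mxvecK nilpotent_exp // mxE.
    by rewrite !row_mxvecK !mulNmx !mul1mx AB subrr mxE.
  move=> h0; exists (mx1 x, mx2 x); last first.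
    by rewrite /pair_coords /= !vec_mxK hsubmxK.
  split=> /=.
    by exists n; apply/matrixP => i j; rewrite [RHS]mxE; apply: (h0 (true, i, j)).
  apply/eqP; rewrite -subr_eq0; apply/eqP/matrixP => i j.
  rewrite [RHS]mxE; have := h0 (false, i, j).
  by rewrite /h /F !mulNmx !mul1mx.
apply: zariski_closed_regular => -[[[] i] j]; rewrite /h /=.
  exact: (mxregularXn _ (@mx2_regular n setT)).
have [r1 r2] := (@mx1_regular n setT, @mx2_regular n setT).
by apply: mxregularD; [apply: mxregularD|]; apply: mxregularM => //;
  [exact: mxregular_cst | exact: mxregularM | exact: mxregular_cst | exact: mxregularXn].
Qed.

End ClosedLocus.

(** * A shift matrix and its companions *)

Section BaseMatrices.
Variables (L : closedFieldType) (n a : nat).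
Local Notation M := ('M[L]_n.+1).

Definition shift_mx : M := \matrix_(i, j) (i == j.+1 :> nat)%:R.
Local Notation J := shift_mx.

(** J maps the j-th basis column vector to the next one, and the last one to
    zero. *)
Lemma shift_mx_exp k (i j : 'I_n.+1) : (J ^+ k) i j = (i == (j + k)%N :> nat)%:R.
Proof.
elim: k i j => [|k IH] i j; first by rewrite addn0 expr0 mxE.
rewrite mxexpSr mxE; have [lt_jn|le_nj] := ltnP j.+1 n.+1.
  rewrite (bigD1 (Ordinal lt_jn)) //= IH mxE eqxx mulr1 addSnnS big1 ?addr0 // => l.
  by rewrite mxE -val_eqE /= => /negPf ->; rewrite mulr0.
rewrite big1 => [|l _]; last first.
  by rewrite [J l j]mxE (ltn_eqF (leq_trans (ltn_ord l) le_nj)) mulr0.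
rewrite addnS -addSn ltn_eqF // (leq_trans (ltn_ord i)) //.
by rewrite (leq_trans le_nj) ?leq_addr.
Qed.

Definition index_mx : M := diag_mx (\row_j (nat_of_ord j)%:R).

(** The solutions B of J B - B J = J^(a+1) form the affine space
    of the sums of - J^a D and a polynomial in J, where D = diag(0, 1, ...)
    satisfies D J - J D = J; here the polynomial has no constant term, so that
    B is nilpotent when a > 0. The first column of J^a D is zero, so the
    coefficients c can be read off the first column. *)
Definition base_mx (c : 'I_n.+1 -> L) : M :=
  - (J ^+ a *m index_mx) + \sum_(k | k != ord0) c k *: J ^+ k.

Lemma base_mx_commutator c : J *m base_mx c - base_mx c *m J = J ^+ a.+1.
Proof.
have DJ : index_mx *m J - J *m index_mx = J.
  apply/matrixP => i j; rewrite mul_diag_mx mul_mx_diag !mxE.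
  case: eqP => [->|_]; last by rewrite mulr0 mul0r subrr.
  by rewrite mulr1 mul1r -natrB // subSnn.
have JJ k : J *m J ^+ k = J ^+ k *m J by rewrite -mxexpS mxexpSr.
rewrite /base_mx mulmxDr mulmxDl mulmxN mulNmx opprD opprK addrACA.
rewrite mulmx_sumr mulmx_suml -sumrB big1 ?addr0.
  by rewrite addrC mulmxA JJ -!mulmxA -mulmxBr DJ -mxexpSr.
by move=> k _; rewrite -scalemxAr -scalemxAl JJ subrr.
Qed.

Lemma base_mx_col0 c i : base_mx c i ord0 = if i == ord0 then 0 else c i.
Proof.
rewrite mxE mxE mul_mx_diag !mxE mulr0 oppr0 add0r summxE.
rewrite (eq_bigr (fun k => c k * (i == k)%:R)) => [|k _]; last first.
  by rewrite mxE shift_mx_exp add0n.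
case: (eqVneq i ord0) => [->|i0].
  by rewrite big1 // => k /negPf k0; rewrite eq_sym k0 mulr0.
rewrite (bigD1 i) //= eqxx mulr1 big1 ?addr0 // => k /andP[_ /negPf ki].
by rewrite eq_sym ki mulr0.
Qed.

Lemma strict_lower_nilpotent (N : M) :
  (forall i j : 'I_n.+1, (i <= j)%N -> N i j = 0) -> nilpotent_mx N.
Proof.
move=> N0; exists n.+1.
have Nk k (i j : 'I_n.+1) : (i < j + k)%N -> (N ^+ k) i j = 0.
  elim: k i j => [|k IH] i j lt_ij.
    by rewrite expr0 mxE -val_eqE /= ltn_eqF // -(addn0 j).
  rewrite mxexpSr mxE big1 // => l _.
  have [le_lj|lt_jl] := leqP l j; first by rewrite N0 ?mulr0.
  by rewrite IH ?mul0r //; apply: leq_trans lt_ij _; rewrite addnS -addSn leq_add2r.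
apply/matrixP => i j; rewrite Nk ?mxE // (leq_trans (ltn_ord i)) //.
exact: leq_addl.
Qed.

Lemma base_mx_nilpotent c : (0 < a)%N -> nilpotent_mx (base_mx c).
Proof.
move=> a_gt0; apply: strict_lower_nilpotent => i j le_ij.
have Jij k : (0 < k)%N -> (J ^+ k) i j = 0.
  by move=> k_gt0; rewrite shift_mx_exp ltn_eqF // -addn1 leq_add.
rewrite mxE mxE mul_mx_diag mxE Jij // mul0r oppr0 add0r summxE big1 // => k k0.
by rewrite mxE Jij ?mulr0 // lt0n.
Qed.
End BaseMatrices.

(** * The lower bound *)

Section LowerBound.
Variables (L : closedFieldType) (n a : nat).
Hypothesis a_gt0 : (0 < a)%N.
Hypothesis two_neq0 : 2%:R != 0 :> L.
Local Notation M := ('M[L]_n.+1).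
Local Notation J := (shift_mx L n).
Local Notation param := ('I_(n.+1 * n.+1) -> L).

(** A generic A in the regular nilpotent orbit has the first basis
    vector e_0 as a cyclic vector. It is then g J g^-1 for a unique g with
    first column e_0, namely the matrix with columns A^j e_0; and B is
    g N g^-1 with N as above. This uses n^2 - n parameters for g and n - 1 for
    N. They are the entries of one n by n matrix x: the first column holds the
    coefficients of N, its entry (0, 0) being ignored, and the other columns
    hold g - 1, so that x = 0 gives the base point g = 1. *)
Definition param_basis (x : param) : M := \matrix_(i, j)
  ((i == j)%:R + if j == ord0 then 0 else x (mxvec_index i j)).
Definition param_base (x : param) : M :=
  base_mx a (fun i => x (mxvec_index i ord0)).
Definition param_point (x : param) : M * M :=
  let g := param_basis x in
  (g *m J *m invmx g, g *m param_base x *m invmx g).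

Lemma param_basis_regular U : mxregular id U param_basis.
Proof.
move=> i j; apply: (@regular_eq _ _ _ _ _ (fun x : param =>
    (i == j)%:R + if j == ord0 then 0 else x (mxvec_index i j))).
  by move=> x _; rewrite mxE.
apply: regularD; first exact: regular_cst.
by case: (j == ord0); [apply: regular_cst | apply: (@regular_coord _ _ _ id)].
Qed.

Lemma param_base_regular U : mxregular id U param_base.
Proof.
apply: mxregularD; first exact: mxregular_cst.
move=> i j; apply: (@regular_eq _ _ _ _ _ (fun x => \sum_(k | k != ord0)
   x (mxvec_index k ord0) * (J ^+ k) i j)).
  by move=> x _; rewrite summxE; apply: eq_bigr => k _; rewrite mxE.
apply: regular_sum => k _; apply: regularM; last exact: regular_cst.
exact: (@regular_coord _ _ _ id).
Qed.

Section Point.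
Variable x : param.
Hypothesis ug : param_basis x \in unitmx.
Local Notation g := (param_basis x).
Let A := (param_point x).1.
Let B := (param_point x).2.

Lemma param_point_Sset : @Sset L n.+1 a.+1 (param_point x).
Proof.
split=> /=.
  have [k Nk] := base_mx_nilpotent (L := L) (n := n) (fun i => x (mxvec_index i ord0)) a_gt0.
  by exists k.+1; rewrite conj_exp // mxexpS /param_base Nk mulmx0 mulmx0 mul0mx.
rewrite conj_exp // -(base_mx_commutator a (fun i => x (mxvec_index i ord0))).
by rewrite mulmxBr mulmxBl !mulmxA !(mulmxKV ug).
Qed.

Let e0 : 'cV[L]_n.+1 := delta_mx ord0 0.

Let g_e0 : invmx g *m e0 = e0.
Proof.
have ge0 : g *m e0 = e0.
  by apply/colP => i; rewrite -colE !mxE /= addr0 eqxx andbT.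
by rewrite -[in LHS]ge0 mulKmx.
Qed.

Let e0E p (N : 'M[L]_(p, n.+1)) i : N i ord0 = (N *m e0) i 0.
Proof. by rewrite -colE mxE. Qed.

Lemma param_point_krylov i (j : 'I_n.+1) : (A ^+ j) i ord0 = g i j.
Proof.
have -> : A ^+ j = g *m J ^+ j *m invmx g.
  by case: (val j) => [|k]; [rewrite expr0 mulmx1 mulmxV | rewrite -conj_exp].
rewrite e0E -!mulmxA g_e0 -colE.
have -> : col ord0 (J ^+ j) = delta_mx j 0.
  apply/colP => k; rewrite mxE shift_mx_exp add0n mxE eqxx andbT.
  by rewrite -val_eqE.
by rewrite -colE mxE.
Qed.

(** B e_0 = g N e_0, and the adjugate replaces the inverse of g at the price of
    the factor det g. *)
Lemma param_point_col0 i :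
  (\adj (\matrix_(i, j) (A ^+ j) i ord0) *m B) i ord0 =
  \det g * if i == ord0 then 0 else x (mxvec_index i ord0).
Proof.
have -> : \matrix_(i, j) (A ^+ j) i ord0 = g.
  by apply/matrixP => k l; rewrite mxE param_point_krylov.
rewrite e0E /B /param_point /= -!mulmxA g_e0 !mulmxA mul_adj_mx.
by rewrite mul_scalar_mx -scalemxAl -colE [LHS]mxE [X in _ * X]mxE base_mx_col0.
Qed.
End Point.

(** Functions of (A, B) that recover the parameter x_(i, j), up to a unit. *)
Definition separator (i j : 'I_n.+1) (y : 'rV[L]_(n.+1 * n.+1 + n.+1 * n.+1)) : L :=
  if j == ord0 then
    (\adj (\matrix_(i, j) (mx1 y ^+ j) i ord0) *m mx2 y) i ord0
  else (mx1 y ^+ j) i ord0 - (i == j)%:R.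

Lemma separator_regular i j : regular (@coords L _) setT (separator i j).
Proof.
have r1 k : mxregular (@coords L _) setT (fun y => @mx1 L n.+1 y ^+ k).
  exact/mxregularXn/mx1_regular.
rewrite /separator; case: (j == ord0).
  apply: (mxregularM (mxregular_adj _) (@mx2_regular L n.+1 setT)).
  by move=> k l; apply: regular_eq (r1 l k ord0) => y _; rewrite mxE.
by apply: regularD; [apply: r1 | apply: regular_cst].
Qed.

Lemma separatorE x (i j : 'I_n.+1) : param_basis x \in unitmx ->
  (i, j) != (ord0, ord0) ->
  separator i j (pair_coords (param_point x)) =
  (if j == ord0 then \det (param_basis x) else 1) * x (mxvec_index i j).
Proof.
move=> ug; rewrite xpair_eqE /separator /mx1 /mx2 /pair_coords !row_mxvecK.
have [->|j0] := eqVneq j ord0; last first.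
  by rewrite param_point_krylov // mxE (negPf j0) addrC addKr mul1r.
by rewrite andbT param_point_col0 // => /negPf ->.
Qed.

(** The inverse is 1 - c E, where E is the elementary matrix and c is 1/2 or 1
    according to whether E is idempotent or of square zero. *)
Lemma unit_add_delta (i j : 'I_n.+1) : 1%:M + delta_mx i j \in @unitmx L n.+1.
Proof.
pose c : L := (1 + (j == i)%:R)^-1.
have c0 : 1 + (j == i)%:R != 0 :> L.
  by case: (j == i); rewrite ?addr0 ?oner_neq0.
have /mulmx1_unit[] // : (1%:M + delta_mx i j) *m (1%:M - c *: delta_mx i j) = 1%:M.
rewrite mulmxBr mulmx1 -scalemxAr mulmxDl mul1mx mul_delta_mx_cond.
rewrite -scaler_nat -[X in X + _ *: _]scale1r -scalerDl scalerA mulVf //.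
by rewrite scale1r addrK.
Qed.

(** One step for each entry of x except the ignored one. *)
Lemma Sset_chain :
  exists Z, irreducible_chain (@pair_coords L n.+1 @` @Sset L n.+1 a.+1)
              (n.+1 ^ 2 - 1) Z.
Proof.
pose k0 : 'I_(n.+1 * n.+1) := mxvec_index ord0 ord0.
have <- : size [seq k <- enum 'I_(n.+1 * n.+1) | k != k0] = (n.+1 ^ 2 - 1)%N.
  rewrite -rem_filter ?enum_uniq // size_rem ?mem_enum //.
  by rewrite size_enum_ord subn1.
have unitE x : (\det (param_basis x) != 0) = (param_basis x \in unitmx).
  by rewrite unitmxE unitfE.
apply: (@param_chain L _ _ (fun x => \det (param_basis x))
  (fun x => pair_coords (param_point x))).
- exact/regular_det/param_basis_regular.
- have -> : param_basis (fun=> 0) = 1%:M.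
    by apply/matrixP => i j; rewrite !mxE if_same addr0.
  by rewrite det1 oner_neq0.
- set U := [set x | _].
  have rV : mxregular id U (fun x => invmx (param_basis x)).
    apply: mxregularV (param_basis_regular U) => x /=.
    by rewrite /U /= unitE.
  have rB := param_basis_regular U.
  rewrite /pair_coords /=.
  apply: mxregular_row_mx; apply: mxregular_mxvec; apply: mxregularM => //;
    apply: mxregularM => //; [exact: mxregular_cst | exact: param_base_regular].
- exact: Sset_closed.
- move=> x /=; rewrite unitE => ug; exists (param_point x) => //.
  exact: param_point_Sset.
- by rewrite filter_uniq // enum_uniq.
move=> k; rewrite mem_filter => /andP[+ _].
case/mxvec_indexP: k => i j ij0.
have {}ij0 : (i, j) != (ord0, ord0) by apply: contraNneq ij0 => -[-> ->].
exists (separator i j); first exact: separator_regular.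
split=> [x /=|].
  by rewrite unitE => ug x0; rewrite separatorE // x0 mulr0.
pose x : param := mxvec (delta_mx i j) 0.
have xE k l : x (mxvec_index k l) = ((k == i) && (l == j))%:R.
  by rewrite /x mxvecE mxE.
have ug : param_basis x \in unitmx.
  have [j0|j0] := eqVneq j ord0.
    suff -> : param_basis x = 1%:M by apply: unitmx1.
    apply/matrixP => k l; rewrite !mxE xE j0.
    by case: (eqVneq l ord0) => _; rewrite ?andbF addr0.
  suff -> : param_basis x = 1%:M + delta_mx i j by apply: unit_add_delta.
  apply/matrixP => k l; rewrite !mxE xE.
  by case: (eqVneq l ord0) => [->|//]; rewrite [ord0 == j]eq_sym (negPf j0) andbF.
exists x; first by rewrite /= unitE.
split=> [l|].
  case/mxvec_indexP: l => k l kl; rewrite xE.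
  by case: andP => // -[/eqP ki /eqP lj]; rewrite ki lj eqxx in kl.
rewrite separatorE // xE !eqxx mulr1; case: ifP => _; last exact: oner_neq0.
by rewrite unitE.
Qed.
End LowerBound.

(** * The dimension *)

Lemma chain_restrict (L : fieldType) N (X Y : set 'rV[L]_N) d Z :
  Y `<=` X -> irreducible_chain Y d Z -> irreducible_chain X d Z.
Proof.
by move=> YX [irrZ ltZ]; split=> // i /irrZ[irr ZY]; split=> // z /ZY /YX.
Qed.

(** The top of a chain of maximal length is a component, for otherwise a larger
    irreducible closed set would lengthen the chain. So the maximal length of
    chains in V is its dimension. *)
Lemma algebraic_set_dim_chain (L : fieldType) N (V : set 'rV[L]_N) d :
  (exists Z, irreducible_chain V d Z) ->
  (forall e Z, irreducible_chain V e Z -> (e <= d)%N) ->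
  algebraic_set_dim V d.
Proof.
move=> [Z chZ] bound; have [irrZ ltZ] := chZ.
have boundX X e Z' : irreducible_component V X -> irreducible_chain X e Z' -> (e <= d)%N.
  by move=> [_ XV _] /(chain_restrict XV)/bound.
have compZ : irreducible_component V (Z d).
  split; [by case: (irrZ d (leqnn d)) | by case: (irrZ d (leqnn d)) |].
  move=> Y irrY YV ZY; apply: contrapT => nYZ.
  suff /bound : irreducible_chain V d.+1 (fun i => if (i <= d)%N then Z i else Y).
    by rewrite ltnn.
  split=> i le_i; first by case: ifP => [/irrZ|].
  rewrite -ltnS le_i; case: ltnP => [lt_id|le_di]; first exact: ltZ.
  have -> : i = d by apply/eqP; rewrite eqn_leq le_di -ltnS le_i.
  by split=> // YZ; apply: nYZ; apply/seteqP.
split.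
  exists (Z d); split=> //; split; last by move=> e Z' /(boundX _ _ _ compZ).
  exists Z; split=> // i le_id; split; first by case: (irrZ i le_id).
  move=> z; elim: d le_id ltZ {bound boundX compZ chZ irrZ} => [|d IH].
    by rewrite leqn0 => /eqP ->.
  rewrite leq_eqVlt => /orP[/eqP -> //|]; rewrite ltnS => le_id ltZ Zz.
  by apply: (ltZ d (leqnn _)).1; apply: IH => // j lt_jd; apply: ltZ; apply: leqW.
move=> X cX; have [irrX _ _] := cX.
pose P e := `[< exists Z', irreducible_chain X e Z' >].
have exP : exists e, P e.
  by exists 0; apply/asboolP; exists (fun=> X); split=> // i _; split.
have ubP e : P e -> (e <= d)%N by move=> /asboolP[Z' /(boundX _ _ _ cX)].
case: (ex_maxnP exP ubP) => e /asboolP chX maxe.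
exists e; last by apply: ubP; apply/asboolP.
by split=> // e' Z' chZ'; apply: maxe; apply/asboolP; exists Z'.
Qed.

Lemma natr_neq0 (K : fieldType) (L : fieldType) (iota : {rmorphism K -> L}) (n : nat) :
  [pchar K] =i pred0 \/ (exists2 p : nat, p \in [pchar K] & (n < p)%N) ->
  forall m, (0 < m <= n)%N -> m%:R != 0 :> L.
Proof.
move=> hK m /andP[m0 le_mn]; rewrite -(rmorph_nat iota) fmorph_eq0.
case: hK => [/pcharf0P -> |[p pK lt_np]]; first by rewrite -lt0n.
by rewrite -(dvdn_pcharf pK) gtnNdvd // (leq_ltn_trans le_mn).
Qed.

Theorem proposition4 (K : fieldType) (L : closedFieldType)
  (iota : {rmorphism K -> L}) (hL : forall x : L, algebraicOver iota x)
  (n alpha : nat)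
  (hK : [pchar K] =i pred0 \/ exists2 p : nat, p \in [pchar K] & (n < p)%N)
  (ha : (2 <= alpha <= n - 1)%N) :
  algebraic_set_dim (@pair_coords L n @` @Sset L n alpha) (n ^ 2 - 1)%N.
Proof.
have n_neq0 := natr_neq0 iota hK.
case: alpha ha => [|a] // /andP[]; rewrite ltnS => a_gt0 le_an.
case: n n_neq0 le_an {hK} => [|n] // n_neq0 le_an.
apply: algebraic_set_dim_chain.
  apply: Sset_chain => //; apply: n_neq0.
  rewrite subn1 /= in le_an; rewrite /= leqW //; exact: leq_ltn_trans a_gt0 le_an.
move=> e Z /(chain_length_Sset (ltn0Sn n) n_neq0) lt_e.
by rewrite -ltnS subn1 prednK // expn_gt0.
Qed.
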